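(* There exist positive real constants $T, c, C'$ and $q_0$ such that for every prime power $q \ge q_0$ and every set $U \subseteq \mathbb{F}_q^3$ with $|U| \ge Tq$, there is a collection $\mathcal{H}_U \subseteq \mathcal{S}_4(U)$ such that (i) $|\mathcal{H}_U| \ge c\,|U|^4/q$, and (ii) $\Delta_i(\mathcal{H}_U) \le C'\, |U|^{4-i} / q^{1-\frac{i-1}{3}}$ for every integer $i \in \{1,2,3\}$.
   Context: $\mathbb{F}_q$ is the finite field with $q$ elements and $\mathbb{F}_q^3$ is the $3$-dimensional affine space over it. A $k$-flat is a $k$-dimensional affine subspace. For $U \subseteq \mathbb{F}_q^3$, $\mathcal{S}_4(U)$ is the collection of all $4$-element subsets of $U$ that are contained in some $2$-flat (affine plane) of $\mathbb{F}_q^3$. A collection $\mathcal{H} \subseteq \mathcal{S}_4(U)$ is viewed as a $4$-uniform hypergraph with vertex set $U$. $|\mathcal{H}|$ denotes its number of edges. For $S \subseteq U$, $d_{\mathcal{H}}(S)$ is the number of edges of $\mathcal{H}$ containing $S$, and $\Delta_i(\mathcal{H})$ is the maximum of $d_{\mathcal{H}}(S)$ over all $S \subseteq U$ with $|S| = i$. *)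

(* Defs.v *)
From HB Require Import structures.
From mathcomp Require Import all_boot all_order all_algebra.

Set Implicit Arguments.
Unset Strict Implicit.
Unset Printing Implicit Defensive.

Import GRing.Theory.
Local Open Scope ring_scope.

Section Flats.
Variables (F : finFieldType) (n : nat).

(* The direction space of a flat is the row space of a square matrix, so that
   the quantification is over finite types and the predicate is decidable. *)
Definition is_flat (k : nat) (A : {set 'rV[F]_n}) : bool :=
  [exists v : 'rV[F]_n, exists W : 'M[F]_n,
    (\rank W == k) && (A == [set x | (x - v <= W)%MS])].

Definition coplanar4 (U : {set 'rV[F]_n}) : {set {set 'rV[F]_n}} :=
  [set S : {set 'rV[F]_n} |
    [&& S \subset U, #|S| == 4%N &
        [exists P : {set 'rV[F]_n}, is_flat 2 P && (S \subset P)]]].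

End Flats.

Section Hypergraphs.
Variable V : finType.

Definition hdeg (H : {set {set V}}) (S : {set V}) : nat :=
  #|[set e in H | S \subset e]|.

Definition max_hdeg (U : {set V}) (H : {set {set V}}) (i : nat) : nat :=
  \max_(S : {set V} | (S \subset U) && (#|S| == i)) hdeg H S.

End Hypergraphs.

(* Main.v *)
Require Import Defs.
From HB Require Import structures.
From mathcomp Require Import all_boot all_order all_algebra.
From mathcomp Require Import mxabelem reals exp ring lra.

(* Let mu = |U| / q, the average size of a plane section of U.  Since two points
   lie on about q common planes, the variance of the section sizes is small.
   Hence few triples of U span a plane with O(mu) points but not close to mu
   points, and few pairs lie on a line with more than 2 mu points of U.  Unless
   many triples span a plane with more than 8 mu points, few pairs even lie on a
   line with more than 6 mu / 25 points, as the planes through such a line which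
   have about mu points miss a fixed proportion of U.  In both cases a positive
   proportion of the triples of U are noncollinear and span a plane in which their
   three lines cover at most 3/4 of the points of U.

   The family is a maximal set of coplanar 4-subsets of U in general position in
   which no triple has degree more than D, where D is about mu.  Each good triple
   spanning a plane with a points has at least a / 4 extensions to such a 4-set.
   Weighting each extension by 1 / a, those outside the family contain a saturated
   triple, and a saturated triple has total weight O(1), while each member of the
   family has weight O(1 / mu).  This gives the lower bound on the family; the
   degrees of smaller sets are bounded from those of triples. *)

Set Implicit Arguments.
Unset Strict Implicit.
Unset Printing Implicit Defensive.

Import Order.TTheory GRing.Theory Num.Theory.
Local Open Scope ring_scope.

(** * Incidence of points and planes in homogeneous coordinates *)

Section Incidence.
Variable F : finFieldType.
Notation V := 'rV[F]_3.

Definition homog (x : V) : 'rV[F]_(3 + 1) := row_mx x 1%:M.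

(* A nonzero v is the plane of equation u.x + c = 0 with v = (u, c), each affine
   plane arising from #|F| - 1 vectors; the vectors (0, c) are incident to no
   point. *)
Definition inc (v : 'rV[F]_(3 + 1)) (x : V) : bool :=
  (v != 0) && (homog x *m v^T == 0).

(** Affine independence of three points, read off as linear independence of their lifts; in
    particular the points are distinct. *)
Definition ncol (x y z : V) : bool :=
  \rank (homog x + homog y + homog z)%MS == 3%N.

Lemma ncolC12 x y z : ncol x y z = ncol y x z.
Proof. by rewrite /ncol (addsmxC (homog x)). Qed.

Lemma ncolC23 x y z : ncol x y z = ncol x z y.
Proof. by rewrite /ncol -!addsmxA (addsmxC (homog y)). Qed.

Lemma homog_inj x y : (homog x <= homog y)%MS -> x = y.
Proof.
case/sub_rVP=> k; rewrite /homog scale_row_mx => /eq_row_mx [-> /matrixP/(_ 0 0)].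
by rewrite !mxE eqxx mulr1 => <-; rewrite scale1r.
Qed.

Lemma homog_neq0 x : homog x != 0.
Proof.
apply/negP; rewrite /homog => /eqP/matrixP/(_ 0 (rshift 3 0)).
by rewrite row_mxEr !mxE eqxx => /eqP; rewrite oner_eq0.
Qed.

Lemma rank_homog2 x y : x != y -> \rank (homog x + homog y)%MS = 2%N.
Proof.
move=> xy; have rx t : \rank (homog t) = 1%N by rewrite rank_rV homog_neq0.
apply/eqP; rewrite eqn_leq; apply/andP; split.
  by apply: leq_trans (mxrank_adds_leqif _ _).1 _; rewrite !rx.
rewrite ltnNge; apply: contraNN xy => le1; apply/eqP/homog_inj.
have yx : (homog y <= homog x + homog y)%MS by apply: addsmxSr.
have/eqmxP eq_y : (homog y == homog x + homog y)%MS.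
  by rewrite -(mxrank_leqif_eq yx).2 eqn_leq (mxrankS yx) rx.
by rewrite eq_y addsmxSl.
Qed.

Lemma incE v x : inc v x = (v != 0) && (homog x <= kermx v^T)%MS.
Proof. by rewrite /inc; congr (_ && _); apply/eqP/sub_kermxP. Qed.

(** These vectors are the kernel of [A^T], of dimension [4 - \rank A], without zero. Ranks 1, 2 and
    3 count the vectors of the planes through a point, a pair and a noncollinear triple. *)
Lemma card_orthogonal m (A : 'M[F]_(m, 3 + 1)) :
  #|[set v : 'rV[F]_(3 + 1) | (v != 0) && (A <= kermx v^T)%MS]|
  = (#|F| ^ (4 - \rank A) - 1)%N.
Proof.
have -> : [set v | (v != 0) && (A <= kermx v^T)%MS] =
    rowg (kermx A^T) :\ (0 : 'rV[F]_(3 + 1)).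
  apply/setP => v; rewrite !inE; congr (_ && _).
  apply/sub_kermxP/sub_kermxP => h.
    by rewrite -[LHS]trmxK trmx_mul trmxK h trmx0.
  by rewrite -[LHS]trmxK trmx_mul trmxK h trmx0.
have := cardsD1 (0 : 'rV[F]_(3 + 1)) (rowg (kermx A^T)).
by rewrite card_rowg mxrank_ker mxrank_tr inE sub0mx add1n => ->; rewrite subn1.
Qed.

Lemma card_inc1 x : #|[set v | inc v x]| = (#|F| ^ 3 - 1)%N.
Proof.
under eq_finset => v do rewrite incE.
by rewrite card_orthogonal rank_rV homog_neq0.
Qed.

Lemma card_inc2 x y :
  x != y -> #|[set v | inc v x && inc v y]| = (#|F| ^ 2 - 1)%N.
Proof.
move=> xy; have := card_orthogonal (homog x + homog y)%MS.
rewrite (rank_homog2 xy) => <-; apply/eq_card => v; rewrite !inE !incE addsmx_sub.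
by case: (v != 0).
Qed.

Lemma card_inc3 x y z :
  ncol x y z -> #|[set v | [&& inc v x, inc v y & inc v z]]| = (#|F| - 1)%N.
Proof.
move=> /eqP xyz; have := card_orthogonal (homog x + homog y + homog z)%MS.
rewrite xyz expn1 => <-; apply/eq_card => v; rewrite !inE !incE !addsmx_sub.
by case: (v != 0); rewrite // andbA.
Qed.

Lemma ncol_neq x y z : ncol x y z -> x != y.
Proof.
apply: contraTneq => ->; rewrite /ncol neq_ltn; apply/orP; left.
have /leq_ltn_trans-> // : (\rank (homog y + homog y + homog z)%MS <= 2)%N.
apply: leq_trans (mxrank_adds_leqif _ _).1 _.
by rewrite (addsmx_idPl (submx_refl _)) !rank_rV !homog_neq0.
Qed.

(** The lifts of [x], [y], [z] span a space of rank 3, as large as the kernel of [f^T], so they fill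
    that kernel and determine the plane. *)
Lemma inc_coplanar f g x y z w : ncol x y z ->
  inc f x -> inc f y -> inc f z -> inc g x -> inc g y -> inc g z ->
  inc f w -> inc g w.
Proof.
rewrite !incE => /eqP r3 /andP[f0 fx] /andP[_ fy] /andP[_ fz].
move=> /andP[g0 gx] /andP[_ gy] /andP[_ gz] /andP[_ fw].
rewrite g0 /=.
have sf : (homog x + homog y + homog z <= kermx f^T)%MS by rewrite !addsmx_sub fx fy.
have rkf : \rank (kermx f^T) = 3%N by rewrite mxrank_ker mxrank_tr rank_rV f0.
have /eqmxP eq_f : (homog x + homog y + homog z == kermx f^T)%MS.
  by rewrite -(mxrank_leqif_eq sf).2 r3 rkf.
by move: fw; rewrite -eq_f => /submx_trans-> //; rewrite !addsmx_sub gx gy.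
Qed.

(** The lift of [z] already lies in the span of the lifts of [x] and [y], which [f] annihilates. *)
Lemma inc_line f x y z : x != y -> ~~ ncol x y z ->
  inc f x -> inc f y -> inc f z.
Proof.
rewrite !incE => xy cxyz /andP[-> fx] /andP[_ fy] /=.
have sxy : (homog x + homog y <= homog x + homog y + homog z)%MS.
  exact: addsmxSl.
have r2 := rank_homog2 xy.
have r_le : (\rank (homog x + homog y + homog z)%MS <= 3)%N.
  apply: leq_trans (mxrank_adds_leqif _ _).1 _.
  by rewrite r2 rank_rV homog_neq0.
have /eqmxP e : (homog x + homog y == homog x + homog y + homog z)%MS.
  rewrite -(mxrank_leqif_eq sxy).2 eqn_leq (mxrankS sxy) r2 /=.
  by rewrite -ltnS ltn_neqAle r_le cxyz.
suff : (homog x + homog y + homog z <= kermx f^T)%MS.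
  by rewrite !addsmx_sub => /andP[].
by rewrite -e addsmx_sub fx fy.
Qed.

(** A vector incident to a point has a nonzero linear part [u]: otherwise its equation would read
    [c = 0] with [c] nonzero. The direction space is then the kernel of [u^T], of rank 2. *)
Lemma inc_flat f x : inc f x -> is_flat 2 [set w | inc f w].
Proof.
move=> fx; have [f0 fxK] := andP fx.
pose u : 'rV[F]_3 := lsubmx f.
have diff w : (homog w - homog x) *m f^T = (w - x) *m u^T.
  rewrite /homog opp_row_mx add_row_mx subrr -[f in f^T]hsubmxK tr_row_mx.
  by rewrite mul_row_col mul0mx addr0.
have u0 : u != 0.
  apply: contraNneq f0 => u0; move: fxK.
  rewrite -[f in f^T]hsubmxK -/u u0 tr_row_mx mul_row_col trmx0 mulmx0 add0r mul1mx.
  by rewrite -trmx0 (inj_eq trmx_inj) => /eqP r0; rewrite -[f]hsubmxK -/u u0 r0 row_mx0.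
apply/existsP; exists x; apply/existsP; exists (kermx u^T).
rewrite mxrank_ker mxrank_tr rank_rV u0 /=; apply/eqP/setP => w.
rewrite !inE /inc f0 /=; move/eqP: fxK => fxK.
apply/eqP/sub_kermxP => h.
  by rewrite -diff mulmxBl h fxK subrr.
by move: h; rewrite -diff mulmxBl fxK subr0.
Qed.

End Incidence.

(** * Moments of plane sections, and the abundance of good triples *)

Section Counting.
Variables (R : realFieldType) (F : finFieldType) (U : {set 'rV[F]_3}).
Notation V := 'rV[F]_3.

Definition psize (f : 'rV[F]_(3 + 1)) : nat := #|[set x in U | inc f x]|.

(** For [x != y] this counts the points of [U] on the line through [x] and [y]. For [x = y] it is
    all of [U], whence the guards in [rich] and [medium]. *)
Definition lsize (x y : V) : nat := #|[set z in U | ~~ ncol x y z]|.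

Definition cop (x y z w : V) : bool :=
  [exists f, [&& inc f x, inc f y, inc f z & inc f w]].

(** No plane has to be chosen: by [span_sizeE] any plane through a noncollinear triple gives this
    number. *)
Definition span_size (x y z : V) : nat := #|[set w in U | cop x y z w]|.

Local Notation q := (#|F|%:R : R).
Local Notation N := (#|U|%:R : R).
Local Notation mu := (N / q).
Local Notation sz f := ((psize f)%:R : R).

Lemma natr_and (b c : bool) : (b && c)%:R = b%:R * c%:R :> R.
Proof. by case: b; rewrite ?mul1r ?mul0r. Qed.

Lemma sum_mem (T : finType) (A : {set T}) (P : pred T) :
  \sum_(x in A) (P x)%:R = #|[set x in A | P x]|%:R :> R.
Proof.
rewrite -natr_sum; congr (_%:R); rewrite -sum1_card big_mkcond /=.
rewrite [RHS]big_mkcond; apply: eq_bigr => x _; rewrite inE.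
by case: (x \in A); case: (P x).
Qed.

Lemma sum_pred (T : finType) (P : pred T) :
  \sum_x (P x)%:R = #|[set x | P x]|%:R :> R.
Proof.
rewrite -natr_sum; congr (_%:R); rewrite -sum1_card big_mkcond /=.
by rewrite [RHS]big_mkcond; apply: eq_bigr => x _; rewrite inE; case: (P x).
Qed.

Lemma sum_const (T : finType) (A : {set T}) (c : R) :
  \sum_(x in A) c = #|A|%:R * c.
Proof. by rewrite sumr_const mulr_natl. Qed.

Lemma card_field_gt1 : (1 < #|F|)%N.
Proof. exact: card_finNzRing_gt1. Qed.

Lemma q_ge2 : 2 <= q.
Proof. by rewrite (ler_nat R 2) card_field_gt1. Qed.

Lemma q_neq0 : q != 0.
Proof. by have q2 := q_ge2; rewrite gt_eqF //; lra. Qed.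

Lemma natr_expB1 (k : nat) : (#|F| ^ k - 1)%:R = q ^+ k - 1 :> R.
Proof.
by rewrite natrB ?natrX // expn_gt0 (ltn_trans _ card_field_gt1).
Qed.

Lemma sum_inc1 (x : V) : \sum_f (inc f x)%:R = q ^+ 3 - 1 :> R.
Proof. by rewrite sum_pred card_inc1 natr_expB1. Qed.

Lemma sum_inc2 (x y : V) : x != y -> \sum_f (inc f x && inc f y)%:R = q ^+ 2 - 1 :> R.
Proof. by move=> xy; rewrite sum_pred card_inc2 // natr_expB1. Qed.

Lemma sum_inc3 (x y z : V) : ncol x y z ->
  \sum_f [&& inc f x, inc f y & inc f z]%:R = q - 1 :> R.
Proof. by move=> xyz; rewrite sum_pred card_inc3 // -(expn1 #|F|) natr_expB1. Qed.

Lemma sum_psize : \sum_f sz f = N * (q ^+ 3 - 1).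
Proof.
under eq_bigr => f _ do rewrite -sum_mem.
rewrite exchange_big /=; under eq_bigr => x _ do rewrite sum_inc1.
by rewrite sum_const.
Qed.

Lemma psizeX2 f : sz f ^+ 2 =
  \sum_(x in U) \sum_(y in U) (inc f x && inc f y)%:R.
Proof.
rewrite expr2 -sum_mem mulr_suml; apply: eq_bigr => x _.
by rewrite mulr_sumr; apply: eq_bigr => y _; rewrite natr_and.
Qed.

Lemma psizeX3 f : sz f ^+ 3 =
  \sum_(x in U) \sum_(y in U) \sum_(z in U) [&& inc f x, inc f y & inc f z]%:R.
Proof.
rewrite exprS psizeX2 -[X in X * _]sum_mem mulr_suml; apply: eq_bigr => x _.
rewrite mulr_sumr; apply: eq_bigr => y _.
by rewrite mulr_sumr; apply: eq_bigr => z _; rewrite -natr_and.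
Qed.

Lemma sum_eq (x : V) : x \in U -> \sum_(y in U) (x == y)%:R = 1 :> R.
Proof.
move=> xU; rewrite (bigD1 x) //= eqxx big1 ?addr0 // => y /andP[_ yx].
by rewrite eq_sym (negPf yx).
Qed.

Lemma sum_psizeX2 :
  \sum_f sz f ^+ 2 = N ^+ 2 * (q ^+ 2 - 1) + N * (q ^+ 3 - q ^+ 2).
Proof.
under eq_bigr => f _ do rewrite psizeX2.
rewrite exchange_big /=.
transitivity (\sum_(x in U) (N * (q ^+ 2 - 1) + (q ^+ 3 - q ^+ 2))); last first.
  by rewrite sum_const; ring.
apply: eq_bigr => x xU; rewrite exchange_big /=.
transitivity (\sum_(y in U) ((q ^+ 2 - 1) + (x == y)%:R * (q ^+ 3 - q ^+ 2))).
  apply: eq_bigr => y _; have [<-|xy] := eqVneq x y.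
    under eq_bigr => f _ do rewrite andbb.
    by rewrite sum_inc1 mulr1n mul1r; ring.
  by rewrite sum_inc2 // mul0r addr0.
by rewrite big_split /= sum_const -mulr_suml sum_eq // mul1r.
Qed.

(** Expanding the square over all [q ^+ 4] vectors, the two sides differ by exactly
    [N ^+ 2 * (q - 2) / q], which is nonnegative. *)
Lemma psize_variance :
  \sum_f (sz f - mu) ^+ 2 <= (q - 1) * N * q ^+ 2.
Proof.
have q2 := q_ge2; have q0 : q != 0 by rewrite gt_eqF //; lra.
have -> : \sum_f (sz f - mu) ^+ 2 =
    \sum_f sz f ^+ 2 + (- 2 * mu) * \sum_f sz f + q ^+ (3 + 1) * mu ^+ 2.
  have <- : \sum_(f : 'rV[F]_(3 + 1)) mu ^+ 2 = q ^+ (3 + 1) * mu ^+ 2.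
    by rewrite sumr_const card_mx mul1n -natrX [RHS]mulr_natl.
  rewrite mulr_sumr -!big_split /=; apply: eq_bigr => f _; ring.
rewrite sum_psizeX2 sum_psize.
have -> : N ^+ 2 * (q ^+ 2 - 1) + N * (q ^+ 3 - q ^+ 2) +
     - 2 * mu * (N * (q ^+ 3 - 1)) + q ^+ (3 + 1) * mu ^+ 2 =
  (q - 1) * N * q ^+ 2 - N ^+ 2 * (q - 2) / q by field.
have : 0 <= N ^+ 2 * (q - 2) / q.
  by rewrite divr_ge0 ?mulr_ge0 ?exprn_ge0 ?subr_ge0.
lra.
Qed.

Lemma span_sizeE f x y z : ncol x y z -> inc f x -> inc f y -> inc f z ->
  span_size x y z = psize f.
Proof.
move=> xyz fx fy fz; rewrite /span_size /psize; apply: eq_card => w.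
rewrite !inE; congr (_ && _); apply/existsP/idP => [[g /and4P[gx gy gz gw]]|fw].
  exact: (@inc_coplanar _ g f x y z w).
by exists f; rewrite fx fy fz.
Qed.

Lemma lsize_le f x y : x != y -> inc f x -> inc f y -> (lsize x y <= psize f)%N.
Proof.
move=> xy fx fy; apply/subset_leq_card/subsetP => z; rewrite !inE.
by case/andP=> -> /(inc_line xy)->.
Qed.

Lemma psize_split f x y : x != y -> inc f x -> inc f y ->
  sz f = (lsize x y)%:R + \sum_(z in U) (ncol x y z && inc f z)%:R.
Proof.
move=> xy fx fy; rewrite -!sum_mem -big_split; apply: eq_bigr => z _ /=.
have := @inc_line F f x y z xy; case: (ncol x y z) => /=; first by rewrite add0r.
by move=> -> //; rewrite addr0.
Qed.

Definition rich x y := (x != y) && (2 * mu < (lsize x y)%:R).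

(** Every plane through a rich pair has more than [2 * mu] points, hence [psize] less than twice its
    deviation from [mu]. Each rich pair is counted by [q ^+ 2 - 1] vectors, so four times the
    variance bounds [q ^+ 2 - 1] times the number of rich pairs. *)
Lemma sum_rich :
  \sum_(x in U) \sum_(y in U) (rich x y)%:R <= 4 * N * q.
Proof.
have q2 := q_ge2; have N0 : 0 <= N by [].
have mu0 : 0 <= mu by rewrite divr_ge0 //; lra.
have h : (q ^+ 2 - 1) * (\sum_(x in U) \sum_(y in U) (rich x y)%:R) <=
    4 * ((q - 1) * N * q ^+ 2).
  apply: le_trans (_ : _ <= 4 * \sum_f (sz f - mu) ^+ 2) _; last first.
    by rewrite ler_wpM2l // psize_variance.
  rewrite [leRHS]mulr_sumr.
  apply: le_trans (_ : \sum_f \sum_(x in U) \sum_(y in U)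
     (rich x y)%:R * (inc f x && inc f y)%:R <= _); last first.
    apply: ler_sum => f _; have [big|small] := ltP (2 * mu) (sz f).
      apply: le_trans (_ : sz f ^+ 2 <= _); last by nra.
      rewrite psizeX2; apply: ler_sum => x _; apply: ler_sum => y _.
      by case: (rich x y); rewrite ?mul1r ?mul0r.
    rewrite big1 => [|x _]; first by rewrite mulr_ge0 // sqr_ge0.
    rewrite big1 // => y _.
    have [/andP[xy r]|] := boolP (rich x y); last by rewrite mul0r.
    have [/andP[fx fy]|] := boolP (inc f x && inc f y); last by rewrite mulr0.
    have := lsize_le xy fx fy; rewrite -(ler_nat R) => le.
    by have := lt_le_trans (lt_le_trans r le) small; rewrite ltxx.
  rewrite [leRHS]exchange_big [leLHS]mulr_sumr /=; apply: ler_sum => x _.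
  rewrite [leRHS]exchange_big [leLHS]mulr_sumr /=; apply: ler_sum => y _.
  rewrite -mulr_sumr; have [/andP[xy _]|_] := boolP (rich x y).
    by rewrite sum_inc2 // mulrC.
  by rewrite !mul0r mulr0.
set S := \sum_(x in U) _ in h *.
have S0 : 0 <= S by apply: sumr_ge0 => x _; apply: sumr_ge0.
have h1 : (q + 1) * S <= 4 * N * q ^+ 2.
  by rewrite -(ler_pM2l (_ : 0 < q - 1)); [nra | lra].
rewrite -(ler_pM2l (_ : 0 < q)); nra.
Qed.

(** The predicates [light], [typical] and [heavy] partition the noncollinear triples. The cap at
    [8 * mu] is what lets the variance control the cubes of the section sizes. *)
Definition light x y z := [&& ncol x y z, (span_size x y z)%:R <= 8 * mu &
  mu < 25 * `|(span_size x y z)%:R - mu|].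

Definition typical x y z :=
  ncol x y z && (25 * `|(span_size x y z)%:R - mu| <= mu).

Definition heavy x y z := ncol x y z && (8 * mu < (span_size x y z)%:R).

Hypothesis U0 : 0 < N.

Lemma mu_gt0 : 0 < mu.
Proof. by have q2 := q_ge2; rewrite divr_gt0 //; lra. Qed.

(** A plane with [a] points carries at most [a ^+ 3] such triples. Here [a ^+ 3] is at most
    [512 * mu ^+ 3], and [mu ^+ 2] is at most 625 times the squared deviation, so the variance bound
    applies. *)
Lemma sum_light :
  \sum_(x in U) \sum_(y in U) \sum_(z in U) (light x y z)%:R <=
  512 * 625 * N ^+ 2 * q.
Proof.
have q2 := q_ge2; have m0 := mu_gt0.
pose P f := (sz f <= 8 * mu) && (mu < 25 * `|sz f - mu|).
have h : (q - 1) * (\sum_(x in U) \sum_(y in U) \sum_(z in U) (light x y z)%:R) <=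
   \sum_f (P f)%:R * sz f ^+ 3.
  apply: le_trans (_ : \sum_f \sum_(x in U) \sum_(y in U) \sum_(z in U)
     (light x y z)%:R * [&& inc f x, inc f y & inc f z]%:R <= _); last first.
    apply: ler_sum => f _; rewrite psizeX3 !mulr_sumr.
    apply: ler_sum => x _; rewrite !mulr_sumr.
    apply: ler_sum => y _; rewrite !mulr_sumr.
    apply: ler_sum => z _; rewrite -!natr_and ler_nat.
    have [/and3P[fx fy fz]|] := boolP [&& inc f x, inc f y & inc f z]; last by rewrite !andbF.
    rewrite !andbT /light; have [xyz|//] := boolP (ncol x y z).
    by rewrite (span_sizeE xyz fx fy fz).
  rewrite [leRHS]exchange_big [leLHS]mulr_sumr /=; apply: ler_sum => x _.
  rewrite [leRHS]exchange_big [leLHS]mulr_sumr /=; apply: ler_sum => y _.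
  rewrite [leRHS]exchange_big [leLHS]mulr_sumr /=; apply: ler_sum => z _.
  rewrite -mulr_sumr; have [/and3P[xyz _ _]|_] := boolP (light x y z).
    by rewrite sum_inc3 // mulrC.
  by rewrite !mul0r mulr0.
have h2 : \sum_f (P f)%:R * sz f ^+ 3 <= 512 * 625 * mu * \sum_f (sz f - mu) ^+ 2.
  rewrite mulr_sumr; apply: ler_sum => f _.
  have [/andP[le8 gt25]|_] := boolP (P f); last first.
    by rewrite mul0r mulr_ge0 ?sqr_ge0 //; lra.
  rewrite mul1r; apply: le_trans (_ : (8 * mu) ^+ 3 <= _).
    by rewrite lerXn2r ?nnegrE //; have := normr_ge0 (sz f - mu); lra.
  have : mu ^+ 2 <= (25 * `|sz f - mu|) ^+ 2.
    by rewrite lerXn2r ?nnegrE //; have := normr_ge0 (sz f - mu); lra.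
  rewrite [leRHS]exprMn real_normK ?num_real // => /(ler_wpM2l (ltW m0)) le.
  have -> : (8 * mu) ^+ 3 = 512 * (mu * mu ^+ 2) by ring.
  have -> : 512 * 625 * mu * (sz f - mu) ^+ 2 =
     512 * (mu * (25 ^+ 2 * (sz f - mu) ^+ 2)) by ring.
  by rewrite ler_wpM2l.
have h3 := le_trans h (le_trans h2 (ler_wpM2l (mulr_ge0 _ (ltW m0)) psize_variance)).
set S := \sum_(x in U) _ in h h3 *.
rewrite -(ler_pM2l (_ : 0 < q - 1)); last by lra.
apply: le_trans (h3 _) _; first by rewrite mulr_ge0.
by rewrite le_eqVlt; apply/orP; left; apply/eqP; field; exact: q_neq0.
Qed.

(** A typical plane through the line has at most [26 / 25 * mu] points, more than [6 / 25 * mu] of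
    them on the line, so at most [4 / 5 * mu] off it. There are [q + 1] planes through the line,
    each represented by [q - 1] vectors. *)
Lemma sum_typical x y : x \in U -> y \in U -> x != y ->
  6 * mu < 25 * (lsize x y)%:R ->
  \sum_(z in U) (typical x y z)%:R <= 4 / 5 * N * (1 + q^-1).
Proof.
move=> xU yU xy med; have q2 := q_ge2; have m0 := mu_gt0.
have h : (q - 1) * (\sum_(z in U) (typical x y z)%:R) <=
    \sum_f (inc f x && inc f y)%:R * (4 / 5 * mu).
  apply: le_trans (_ : \sum_f \sum_(z in U)
     (typical x y z)%:R * [&& inc f x, inc f y & inc f z]%:R <= _); last first.
    apply: ler_sum => f _.
    have [/andP[fx fy]|nf] := boolP (inc f x && inc f y); last first.
      by rewrite big1 ?mul0r // => z _; rewrite andbA (negPf nf) mulr0.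
    rewrite mul1r fx fy /=.
    have [typ|ntyp] := boolP (25 * `|sz f - mu| <= mu).
      apply: le_trans (_ : \sum_(z in U) (ncol x y z && inc f z)%:R <= _).
        apply: ler_sum => z _; rewrite -natr_and ler_nat /typical.
        by case: (ncol x y z); case: (inc f z); rewrite ?andbF ?andbT ?leq_b1.
      have := psize_split xy fx fy.
      have := ler_norm (sz f - mu); lra.
    rewrite big1 => [|z _]; first by lra.
    rewrite -natr_and; apply/eqP; rewrite pnatr_eq0 eqb0; apply: contra ntyp.
    by move=> /andP[/andP[xyz +] fz]; rewrite (span_sizeE xyz fx fy fz).
  rewrite [leRHS]exchange_big [leLHS]mulr_sumr /=; apply: ler_sum => z _.
  rewrite -mulr_sumr; have [/andP[xyz _]|_] := boolP (typical x y z).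
    by rewrite sum_inc3 // mulrC.
  by rewrite !mul0r mulr0.
rewrite -mulr_suml sum_inc2 // in h.
rewrite -(ler_pM2l (_ : 0 < q - 1)); last by lra.
apply: le_trans h _.
by rewrite le_eqVlt; apply/orP; left; apply/eqP; field; exact: q_neq0.
Qed.

(** Each of the three lines takes at most a quarter of the section, so at least a quarter is left
    for a fourth point in general position. The lower bound on the section caps the weight of an
    extension at [2 / mu]. *)
Definition good x y z :=
  [&& ncol x y z, mu <= 2 * (span_size x y z)%:R,
    4 * (lsize x y)%:R <= (span_size x y z)%:R :> R,
    4 * (lsize x z)%:R <= (span_size x y z)%:R :> R &
    4 * (lsize y z)%:R <= (span_size x y z)%:R :> R].


Definition sum3 (p : V -> V -> V -> R) : R :=
  \sum_(x in U) \sum_(y in U) \sum_(z in U) p x y z.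

Lemma sum3D p r : sum3 (fun x y z => p x y z + r x y z) = sum3 p + sum3 r.
Proof.
rewrite -big_split; apply: eq_bigr => x _; rewrite -big_split.
by apply: eq_bigr => y _; rewrite -big_split.
Qed.

Lemma sum3_le p r :
  (forall x y z, x \in U -> y \in U -> z \in U -> p x y z <= r x y z) ->
  sum3 p <= sum3 r.
Proof.
move=> le; apply: ler_sum => x xU; apply: ler_sum => y yU.
by apply: ler_sum => z zU; exact: le.
Qed.

Lemma sum3C12 p : sum3 (fun x y z => p y x z) = sum3 p.
Proof. exact: exchange_big. Qed.

Lemma sum3C23 p : sum3 (fun x y z => p x z y) = sum3 p.
Proof. by apply: eq_bigr => x _; exact: exchange_big. Qed.

Lemma sum3_const2 (p : V -> V -> R) :
  sum3 (fun x y _ => p x y) = N * \sum_(x in U) \sum_(y in U) p x y.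
Proof.
rewrite mulr_sumr; apply: eq_bigr => x _; rewrite mulr_sumr.
by apply: eq_bigr => y _; rewrite sum_const.
Qed.

Lemma sum3_xz p : sum3 (fun x _ z => p x z) = sum3 (fun x y _ => p x y).
Proof. exact: (sum3C23 (fun x y _ => p x y)). Qed.

Lemma sum3_yz p : sum3 (fun _ y z => p y z) = sum3 (fun x y _ => p x y).
Proof. by rewrite -sum3_xz -(sum3C12 (fun x _ z => p x z)). Qed.

Lemma ncol_all_neq (x y z : V) : ncol x y z -> [/\ x != y, x != z & y != z].
Proof.
move=> xyz; split; first exact: ncol_neq xyz.
  by move: xyz; rewrite ncolC23 => /ncol_neq.
by move: xyz; rewrite ncolC12 ncolC23 => /ncol_neq.
Qed.

Definition medium x y := (x != y) && (6 * mu < 25 * (lsize x y)%:R).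

(** Pairs are also counted with a free third point, so that all classes compare with [N ^+ 3]. *)
Let Rich := sum3 (fun x y _ => (rich x y)%:R).
Let Medium := sum3 (fun x y _ => (medium x y)%:R).
Let Light := sum3 (fun x y z => (light x y z)%:R).
Let Typical := sum3 (fun x y z => (typical x y z)%:R).
Let Heavy := sum3 (fun x y z => (heavy x y z)%:R).
Let Good := sum3 (fun x y z => (good x y z)%:R).

(** If none of the three pairs is rich, four times each line is at most [8 * mu], which is below the
    size of the section. *)
Lemma heavy_le_good : Heavy <= Good + 3 * Rich.
Proof.
have -> : Good + 3 * Rich = Good + Rich +
    sum3 (fun x _ z => (rich x z)%:R) + sum3 (fun _ y z => (rich y z)%:R).
  by rewrite sum3_xz sum3_yz -/Rich; ring.
rewrite -!sum3D; apply: sum3_le => x y z _ _ _; have m0 := mu_gt0.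
rewrite -!natrD ler_nat /heavy /good; have [xyz|//] := boolP (ncol x y z).
have [xy xz yz] := ncol_all_neq xyz.
rewrite /rich xy xz yz /=; case: ltP => //= a8.
rewrite !addn_gt0 !lt0b.
case: ltP => [_|b1]; first by rewrite orbT.
case: ltP => [_|b2]; first by rewrite orbT.
case: ltP => [_|b3]; first by rewrite orbT.
rewrite !orbF; apply/and4P; split; lra.
Qed.

(** The section has at least [24 / 25 * mu] points, and four times a line that is not medium is at
    most that: this fixes the threshold [6 / 25]. *)
Lemma typical_le_good : Typical <= Good + 3 * Medium.
Proof.
have -> : Good + 3 * Medium = Good + Medium +
    sum3 (fun x _ z => (medium x z)%:R) + sum3 (fun _ y z => (medium y z)%:R).
  by rewrite sum3_xz sum3_yz -/Medium; ring.
rewrite -!sum3D; apply: sum3_le => x y z _ _ _; have m0 := mu_gt0.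
rewrite -!natrD ler_nat /typical /good; have [xyz|//] := boolP (ncol x y z).
have [xy xz yz] := ncol_all_neq xyz.
rewrite /medium xy xz yz /=; have [dev|//] := boolP (25 * `|(span_size x y z)%:R - mu| <= mu).
have le := ler_norm (mu - (span_size x y z)%:R); rewrite distrC in le.
rewrite !addn_gt0 !lt0b.
case: ltP => [_|b1]; first by rewrite orbT.
case: ltP => [_|b2]; first by rewrite orbT.
case: ltP => [_|b3]; first by rewrite orbT.
rewrite !orbF; apply/and4P; split; lra.
Qed.

(** For [8 <= q] the factor [4 / 5 * (1 + q^-1)] is at most [9 / 10], so over each medium pair a
    tenth of the third points give no typical triple. *)
Lemma typical_medium : 8 <= q -> Typical + Medium / 10 <= N ^+ 3.
Proof.
move=> q8.
have -> : N ^+ 3 = sum3 (fun _ _ _ => 1).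
  by rewrite sum3_const2 !sum_const; ring.
have -> : Medium / 10 = \sum_(x in U) \sum_(y in U) (medium x y)%:R * (N / 10).
  rewrite /Medium sum3_const2 mulrAC mulrC mulr_suml.
  by apply: eq_bigr => x _; rewrite mulr_suml.
rewrite -big_split; apply: ler_sum => x xU; rewrite -big_split /=.
apply: ler_sum => y yU; rewrite [leRHS]sum_const mulr1.
have [/andP[xy med]|_] := boolP (medium x y); last first.
  rewrite mul0r addr0 -[leRHS]mulr1 -sum_const; apply: ler_sum => z _.
  by rewrite lern1 leq_b1.
rewrite mulr1n mul1r.
have le := sum_typical xU yU xy med.
have iq : q^-1 <= 8^-1 by rewrite lef_pV2 // posrE; lra.
have : N * q^-1 <= N * 8^-1 by rewrite ler_wpM2l.
lra.
Qed.

Lemma sum_triples : N ^+ 3 <= N ^+ 2 + Rich + 2 * N ^+ 3 / q + Light + Typical + Heavy.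
Proof.
have m0 := mu_gt0.
have -> : N ^+ 3 = sum3 (fun _ _ _ => 1).
  by rewrite sum3_const2 !sum_const; ring.
have -> : N ^+ 2 = sum3 (fun x y _ => (x == y)%:R).
  rewrite sum3_const2 (eq_bigr (fun=> 1)) ?sum_const; first by ring.
  by move=> x /sum_eq.
(* A pair of distinct points that is not rich has at most [2 * mu] collinear third points. *)
have le : sum3 (fun x y z => [&& x != y, ~~ rich x y & ~~ ncol x y z]%:R)
    <= 2 * sum3 (fun _ _ _ => 1) / q.
  have -> : 2 * sum3 (fun _ _ _ => 1) / q = \sum_(x in U) \sum_(y in U) (2 * mu).
    by rewrite sum3_const2 !sum_const; ring.
  apply: ler_sum => x _; apply: ler_sum => y _.
  have [nr|ri] := boolP ((x != y) && ~~ rich x y); last first.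
    rewrite big1; first by lra.
    by move=> z _; rewrite andbA (negPf ri).
  have [xy nri] := andP nr; rewrite xy nri /= sum_mem.
  by move: nri; rewrite /rich xy /= -leNgt.
apply: le_trans (_ : _ <= sum3 (fun x y _ => (x == y)%:R) + Rich +
  sum3 (fun x y z => [&& x != y, ~~ rich x y & ~~ ncol x y z]%:R)
  + Light + Typical + Heavy) _; last by lra.
rewrite -!sum3D; apply: sum3_le => x y z _ _ _.
rewrite -!natrD (ler_nat R 1) /light /typical /heavy.
have [_|xy] := eqVneq x y; first by rewrite -!addnA.
have [_|ri] := boolP (rich x y); first by rewrite -!addnA.
have [xyz|//] := boolP (ncol x y z).
case: (ltP mu (25 * _)) => _; last by rewrite addnAC addn1.
by rewrite andbT; case: (leP _ (8 * mu)) => _; rewrite ?addn1.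
Qed.

(** Let [eps * N ^+ 3] be the sum of [N ^+ 2], [4 * Rich], [2 * N ^+ 3 / q] and [Light]. Eliminating
    [Heavy], [Medium] and [Typical] gives [(1 - 31 * eps) * N ^+ 3 <= 32 * Good]. The hypotheses on
    [q] and [N] make [eps] less than [1 / 62]. *)
Lemma good_triples : 512 <= q -> 10 ^+ 8 * q <= N ->
  N ^+ 3 <= 64 * Good.
Proof.
move=> q512 hT.
have h1 := sum_triples; have h2 := heavy_le_good; have h3 := typical_le_good.
have h4 : Typical + Medium / 10 <= N ^+ 3 by apply: typical_medium; lra.
have h5 : Light <= 512 * 625 * N ^+ 2 * q := sum_light.
have h6 : Rich <= N * (4 * N * q).
  by rewrite /Rich sum3_const2 ler_wpM2l // sum_rich.
set W := N ^+ 2 * q.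
have h7 : 10 ^+ 8 * W <= N ^+ 3.
  by rewrite /W mulrCA [leRHS]exprSr ler_wpM2l // exprn_ge0.
have h8 : 2 * N ^+ 3 / q <= N ^+ 3 / 256.
  have -> : N ^+ 3 / 256 = 2 * N ^+ 3 * 512^-1 by field.
  by rewrite ler_wpM2l ?mulr_ge0 // lef_pV2 // posrE; lra.
have h9 : N ^+ 2 <= W by rewrite /W ler_peMr ?exprn_ge0 //; lra.
have {}h5 : Light <= 512 * 625 * W by rewrite /W mulrA.
have {}h6 : Rich <= 4 * W by apply: le_trans h6 _; rewrite /W; lra.
have W0 : 0 <= W by rewrite mulr_ge0 ?exprn_ge0.
have {}h7 : 10000 * 10000 * W <= N ^+ 3 by apply: le_trans h7; lra.
move: h1 h2 h3 h4 h5 h6 h7 h8 h9 W0.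
move: Typical Heavy Light Rich Medium Good W (N ^+ 3) (N ^+ 2) (2 * _ / q) => *.
lra.
Qed.

End Counting.

(** * Degrees in uniform hypergraphs *)

Section Hypergraph.
Local Open Scope nat_scope.
Variable V : finType.
Implicit Types (G H : {set {set V}}) (S e U : {set V}) (D k : nat).

(** Adding [e] to an inclusion-maximal [H] breaks the bound at some [S]. Only subsets of [e] gain
    degree, and they gain one, so [S] lies in [e] and had degree at least [D] before. *)
Lemma maximal_bounded_degree G k D :
  exists H, [/\ H \subset G,
    forall S, #|S| = k -> hdeg H S <= D
  & forall e, e \in G -> e \notin H ->
      exists S, [/\ S \subset e, #|S| = k & D <= hdeg H S]].
Proof.
pose P H := (H \subset G) && [forall S : {set V}, (#|S| == k) ==> (hdeg H S <= D)].
have P0 : P set0.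
  rewrite /P sub0set /=; apply/forallP => S; apply/implyP => _.
  by rewrite /hdeg (eq_card0 (A := [set _ in _ | _])) // => e; rewrite !inE.
have [H /maxsetP[/andP[HG /forallP Hdeg] Hmax] _] := maxset_exists P0.
exists H; split=> // [S kS|e eG eH].
  by have /implyP := Hdeg S; apply; apply/eqP.
have : ~~ P (e |: H).
  apply/negP => /Hmax/(_ (subsetU1 _ _)) eqH.
  by move: eH; rewrite -eqH setU11.
rewrite /P subUset sub1set eG HG /= => /forallPn[S].
rewrite negb_imply -ltnNge => /andP[/eqP kS big]; exists S; split=> //.
  apply: contraTT big => Se; rewrite -leqNgt.
  have := implyP (Hdeg S); rewrite kS eqxx => /(_ isT); apply: leq_trans.
  apply/subset_leq_card/subsetP => f; rewrite !inE.
  by case/andP=> /orP[/eqP->|->]; rewrite ?(negPf Se) // => ->.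
rewrite -ltnS; apply: leq_trans big _.
apply: leq_trans (_ : #|e |: [set f in H | S \subset f]| <= _).
  apply/subset_leq_card/subsetP => f; rewrite !inE.
  by case/andP=> /orP[->|->] // ->; rewrite orbT.
by rewrite cardsU1; case: (_ \notin _).
Qed.

(** Each edge contributes to the degrees of its ['C(m, k)] subsets of size [k]. *)
Lemma double_count_degree H m k D : (forall e, e \in H -> #|e| = m) ->
  D * #|[set S : {set V} | (#|S| == k) && (D <= hdeg H S)]| <= 'C(m, k) * #|H|.
Proof.
move=> Hm; rewrite mulnC -sum_nat_const.
apply: (@leq_trans (\sum_(S : {set V} | #|S| == k) hdeg H S)).
  rewrite [leqRHS](bigID (fun S => D <= hdeg H S)) /=.
  rewrite (eq_bigl (fun S : {set V} => (#|S| == k) && (D <= hdeg H S))); last first.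
    by move=> S; rewrite inE.
  apply: leq_trans (leq_addr _ _); apply: leq_sum => S /andP[_].
  exact.
rewrite /hdeg; under eq_bigr => S _ do rewrite -sum1dep_card.
rewrite (exchange_big_dep (mem H)) /=; last by move=> S e _ /andP[].
rewrite mulnC -sum_nat_const; apply: leq_sum => e eH.
rewrite -(Hm e eH) -cards_draws -sum1dep_card leq_eqVlt; apply/orP; left.
by apply/eqP/eq_bigl => S; rewrite eH andbC.
Qed.

(** Every edge through [S] is larger than [S], so it is counted in the degree of some [x |: S]. *)
Lemma hdeg_extend H U S M :
  (forall e, e \in H -> e \subset U) -> (forall e, e \in H -> #|S| < #|e|) ->
  (forall x, x \in U -> x \notin S -> hdeg H (x |: S) <= M) ->
  hdeg H S <= #|U| * M.
Proof.
move=> HU HS HM.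
apply: (@leq_trans (\sum_(x in U | x \notin S) hdeg H (x |: S))); last first.
  rewrite -sum_nat_const big_mkcondr /=; apply: leq_sum => x xU.
  by case: ifP => // /(HM x xU).
rewrite {2}/hdeg; under eq_bigr => x _ do rewrite -sum1dep_card.
rewrite (exchange_big_dep [in H]) /=; last by move=> x e _ /andP[].
rewrite /hdeg -sum1dep_card big_mkcondr /=; apply: leq_sum => e eH.
case: ifP => // Se; have /subsetPn[x xe xS] : ~~ (e \subset S).
  by apply: contraL (HS e eH) => /subset_leq_card; rewrite -leqNgt.
rewrite (bigD1 x) //= xS (subsetP (HU e eH)) // eH /=.
by rewrite subUset sub1set xe Se.
Qed.

End Hypergraph.

(** * Passing from ordered tuples to sets *)

Section TupleCounting.
Variables (R : realFieldType) (V : finType).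
Implicit Types (U S : {set V}) (A : {set {set V}}).

Lemma sum_mem_le U S : \sum_(x in U) (x \in S)%:R <= #|S|%:R :> R.
Proof.
rewrite sum_mem ler_nat; apply/subset_leq_card/subsetP => x.
by rewrite inE => /andP[].
Qed.

Lemma sum_mem_ge0 U S : 0 <= \sum_(x in U) (x \in S)%:R :> R.
Proof. exact: sumr_ge0. Qed.

Lemma mem_le_sum A S (f : {set V} -> R) : (forall S', 0 <= f S') -> f S = 1 ->
  (S \in A)%:R <= \sum_(S' in A) f S'.
Proof.
move=> f0 f1; have [SA|_] := boolP (S \in A); last exact: sumr_ge0.
by rewrite (bigD1 S) //= f1 lerDl sumr_ge0.
Qed.

(** A set of size [k] contains at most [k ^ 3] ordered triples, repetitions allowed. *)
Lemma sum_set3_le U A k : (forall S, S \in A -> #|S| = k) ->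
  \sum_(x in U) \sum_(y in U) \sum_(z in U) ([set x; y; z] \in A)%:R
  <= k%:R ^+ 3 * #|A|%:R :> R.
Proof.
move=> kA; apply: le_trans (_ : _ <= \sum_(x in U) \sum_(y in U) \sum_(z in U)
    \sum_(S in A) (x \in S)%:R * ((y \in S)%:R * (z \in S)%:R)) _.
  apply: ler_sum => x _; apply: ler_sum => y _; apply: ler_sum => z _.
  apply: mem_le_sum => [S|]; first by rewrite !mulr_ge0.
  by rewrite !inE !eqxx ?orbT !mulr1.
under eq_bigr => x _ do under eq_bigr => y _ do rewrite exchange_big /=.
under eq_bigr => x _ do rewrite exchange_big /=.
rewrite exchange_big /= mulrC -sum_const; apply: ler_sum => S /kA <-.
set s := \sum_(x in U) (x \in S)%:R : R.
have -> : \sum_(x in U) \sum_(y in U) \sum_(z in U)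
     (x \in S)%:R * ((y \in S)%:R * (z \in S)%:R) = s ^+ 3.
  rewrite !exprS expr0 mulr1 {1}/s mulr_suml; apply: eq_bigr => x _.
  rewrite {1}/s mulr_suml mulr_sumr; apply: eq_bigr => y _.
  by rewrite /s !mulr_sumr.
by rewrite lerXn2r ?nnegrE ?sum_mem_ge0 ?sum_mem_le.
Qed.

Lemma sum_set4_le U A k : (forall S, S \in A -> #|S| = k) ->
  \sum_(x in U) \sum_(y in U) \sum_(z in U) \sum_(w in U)
    ([set x; y; z; w] \in A)%:R <= k%:R ^+ 4 * #|A|%:R :> R.
Proof.
move=> kA; apply: le_trans (_ : _ <= \sum_(x in U) \sum_(y in U) \sum_(z in U)
    \sum_(w in U) \sum_(S in A)
      (x \in S)%:R * ((y \in S)%:R * ((z \in S)%:R * (w \in S)%:R))) _.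
  apply: ler_sum => x _; apply: ler_sum => y _; apply: ler_sum => z _.
  apply: ler_sum => w _.
  apply: mem_le_sum => [S|]; first by rewrite !mulr_ge0.
  by rewrite !inE !eqxx ?orbT !mulr1.
under eq_bigr => x _ do under eq_bigr => y _ do
  under eq_bigr => z _ do rewrite exchange_big /=.
under eq_bigr => x _ do under eq_bigr => y _ do rewrite exchange_big /=.
under eq_bigr => x _ do rewrite exchange_big /=.
rewrite exchange_big /= mulrC -sum_const; apply: ler_sum => S /kA <-.
set s := \sum_(x in U) (x \in S)%:R : R.
have -> : \sum_(x in U) \sum_(y in U) \sum_(z in U) \sum_(w in U)
     (x \in S)%:R * ((y \in S)%:R * ((z \in S)%:R * (w \in S)%:R)) = s ^+ 4.
  rewrite !exprS expr0 mulr1 {1}/s mulr_suml; apply: eq_bigr => x _.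
  rewrite {1}/s mulr_suml mulr_sumr; apply: eq_bigr => y _.
  rewrite {1}/s mulr_suml !mulr_sumr; apply: eq_bigr => z _.
  by rewrite /s !mulr_sumr.
by rewrite lerXn2r ?nnegrE ?sum_mem_ge0 ?sum_mem_le.
Qed.

End TupleCounting.

(** * Coplanar quadruples in general position and the charging argument *)

Section Family.
Variables (F : finFieldType) (U : {set 'rV[F]_3}).
Notation V := 'rV[F]_3.

Definition gp4 (x y z w : V) : bool :=
  [&& ncol x y z, ncol x y w, ncol x z w, ncol y z w & cop x y z w].

Definition gp_family : {set {set V}} :=
  [set e : {set V} | [exists x in U, exists y in U, exists z in U, exists w in U,
    gp4 x y z w && (e == [set x; y; z; w])]].

Lemma gp_familyP (e : {set V}) : reflect
  (exists x y z w, [/\ [/\ x \in U, y \in U, z \in U & w \in U], gp4 x y z w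
     & e = [set x; y; z; w]]) (e \in gp_family).
Proof.
rewrite inE; apply: (iffP exists_inP) => [[x xU] /exists_inP[y yU]|].
  case/exists_inP=> z zU /exists_inP[w wU /andP[g /eqP->]].
  by exists x, y, z, w.
case=> x [y [z [w [[xU yU zU wU] g ->]]]].
exists x => //; apply/exists_inP; exists y => //; apply/exists_inP; exists z => //.
by apply/exists_inP; exists w => //; rewrite g eqxx.
Qed.

Lemma gp4_neq x y z w : gp4 x y z w ->
  [/\ x != y, x != z & y != z] /\ [/\ x != w, y != w & z != w].
Proof.
case/and5P=> /ncol_all_neq[xy xz yz] /ncol_all_neq[_ xw yw].
by move=> /ncol_all_neq[_ _ zw].
Qed.

Lemma card_gp4 x y z w : gp4 x y z w -> #|[set x; y; z; w]| = 4%N.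
Proof.
case/gp4_neq=> -[xy xz yz] [xw yw zw].
have E : [set x; y; z; w] =i [:: x; y; z; w] by move=> t; rewrite !inE -!orbA.
rewrite (eq_card E); apply/card_uniqP.
by rewrite /= !inE !negb_or xy xz xw yz yw zw.
Qed.

Lemma gp_family_card e : e \in gp_family -> #|e| = 4%N.
Proof. by case/gp_familyP=> x [y [z [w [_ g ->]]]]; exact: card_gp4. Qed.

Lemma gp_family_sub e : e \in gp_family -> e \subset U.
Proof.
case/gp_familyP=> x [y [z [w [[xU yU zU wU] _ ->]]]].
by rewrite !subUset !sub1set xU yU zU wU.
Qed.

Lemma gp_family_coplanar : gp_family \subset coplanar4 U.
Proof.
apply/subsetP => e eG; rewrite inE gp_family_sub // gp_family_card //=.
case/gp_familyP: eG => x [y [z [w [_ /and5P[_ _ _ _ /existsP[f]]]]]].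
case/and4P=> fx fy fz fw ->; apply/existsP; exists [set t | inc f t].
by rewrite (inc_flat fx) !subUset !sub1set !inE fx fy fz fw.
Qed.

Lemma gp4C12 x y z w : gp4 x y z w = gp4 y x z w.
Proof.
have cC : cop x y z w = cop y x z w by apply: eq_existsb => f; rewrite andbCA.
rewrite /gp4 cC (ncolC12 x y z) (ncolC12 x y w).
by case: (ncol y x z); case: (ncol y x w); case: (ncol x z w); case: (ncol y z w).
Qed.

Lemma gp4C23 x y z w : gp4 x y z w = gp4 x z y w.
Proof.
have cC : cop x y z w = cop x z y w.
  by apply: eq_existsb => f; congr (_ && _); rewrite andbCA.
rewrite /gp4 cC (ncolC23 x y z) (ncolC12 y z w).
by case: (ncol x z y); case: (ncol x y w); case: (ncol x z w); case: (ncol z y w).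
Qed.

Lemma gp4C34 x y z w : gp4 x y z w = gp4 x y w z.
Proof.
have cC : cop x y z w = cop x y w z.
  by apply: eq_existsb => f; do 2 congr (_ && _); rewrite andbC.
rewrite /gp4 cC (ncolC23 x z w) (ncolC23 y z w).
by case: (ncol x y z); case: (ncol x y w); case: (ncol x w z); case: (ncol y w z).
Qed.

Lemma span_size_gp4 x y z w : gp4 x y z w ->
  [/\ span_size U x y w = span_size U x y z,
      span_size U x z w = span_size U x y z
    & span_size U y z w = span_size U x y z].
Proof.
case/and5P=> xyz xyw xzw yzw /existsP[f /and4P[fx fy fz fw]].
by rewrite !(@span_sizeE F U f).
Qed.

Lemma subset_set4_card3 x y z w (S : {set V}) : gp4 x y z w ->
  S \subset [set x; y; z; w] -> #|S| = 3%N ->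
  [\/ S = [set x; y; z], S = [set x; y; w], S = [set x; z; w] | S = [set y; z; w]].
Proof.
move=> g Se S3; have /eqP/cards1P[t et] : #|[set x; y; z; w] :\: S| = 1%N.
  by rewrite cardsD (setIidPr Se) S3 card_gp4.
have te : t \in [set x; y; z; w] by have := set11 t; rewrite -et !inE => /andP[].
have {et} -> : S = [set x; y; z; w] :\ t.
  by rewrite -et setDDr setDv set0U (setIidPr Se).
have [[xy xz yz] [xw yw zw]] := gp4_neq g.
have sym (a b : V) : (a == b) = (b == a) by exact: eq_sym.
move: te; rewrite !inE -!orbA => /or4P[] /eqP->;
  [constructor 4|constructor 3|constructor 2|constructor 1];
  apply/setP => s; rewrite !inE -!orbA.
- have [->|_] //= := eqVneq s x.
  by rewrite (negPf xy) (negPf xz) (negPf xw).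
- have [->|_] //= := eqVneq s y.
  by rewrite (sym y x) (negPf xy) (negPf yz) (negPf yw).
- have [->|_] //= := eqVneq s z.
  by rewrite (sym z x) (sym z y) (negPf xz) (negPf yz) (negPf zw).
- have [->|_] /= := eqVneq s w; last by rewrite orbF.
  by rewrite (sym w x) (sym w y) (sym w z) (negPf xw) (negPf yw) (negPf zw).
Qed.

Variable R : realFieldType.
Local Notation q := (#|F|%:R : R).
Local Notation N := (#|U|%:R : R).
Local Notation mu := (N / q).

Definition sum4 (p : V -> V -> V -> V -> R) : R :=
  \sum_(x in U) \sum_(y in U) \sum_(z in U) \sum_(w in U) p x y z w.

Lemma sum4D p r : sum4 (fun x y z w => p x y z w + r x y z w) = sum4 p + sum4 r.
Proof.
rewrite -big_split; apply: eq_bigr => x _; rewrite -big_split.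
apply: eq_bigr => y _; rewrite -big_split.
by apply: eq_bigr => z _; rewrite -big_split.
Qed.

Lemma sum4_le p r :
  (forall x y z w, x \in U -> y \in U -> z \in U -> w \in U ->
     p x y z w <= r x y z w) ->
  sum4 p <= sum4 r.
Proof.
move=> le; apply: ler_sum => x xU; apply: ler_sum => y yU.
by apply: ler_sum => z zU; apply: ler_sum => w wU; exact: le.
Qed.

Lemma sum4C12 p : sum4 (fun x y z w => p y x z w) = sum4 p.
Proof. exact: exchange_big. Qed.

Lemma sum4C23 p : sum4 (fun x y z w => p x z y w) = sum4 p.
Proof. by apply: eq_bigr => x _; exact: exchange_big. Qed.

Lemma sum4C34 p : sum4 (fun x y z w => p x y w z) = sum4 p.
Proof. by apply: eq_bigr => x _; apply: eq_bigr => y _; exact: exchange_big. Qed.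

(** A point of the section that does not extend the triple lies on one of its three lines, and these
    cover at most three quarters of the section. *)
Lemma good_extensions x y z : good R U x y z ->
  (span_size U x y z)%:R <= 4 * \sum_(w in U) (gp4 x y z w)%:R :> R.
Proof.
case/and5P=> xyz _ b1 b2 b3.
have : (span_size U x y z)%:R <= \sum_(w in U) (gp4 x y z w)%:R +
   (lsize U x y)%:R + (lsize U x z)%:R + (lsize U y z)%:R :> R.
  rewrite -!(sum_mem R U) -!big_split /=; apply: ler_sum => w _.
  rewrite -!natrD ler_nat /gp4 xyz /=.
  by case: (ncol x y w); case: (ncol x z w); case: (ncol y z w); case: (cop _ _ _ _).
lra.
Qed.

Hypothesis U0 : 0 < N.

Variables (H : {set {set V}}) (D : nat).
Hypothesis HG : H \subset gp_family.
Hypothesis Hmax : forall e, e \in gp_family -> e \notin H ->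
  exists S : {set V}, [/\ S \subset e, #|S| = 3%N & (D <= hdeg H S)%N].

Let Sat := [set S : {set V} | (#|S| == 3%N) && (D <= hdeg H S)%N].

(** The first three arguments form the saturated triple; the fourth is the extension. *)
Definition sat_weight x y z w : R :=
  (([set x; y; z] \in Sat) && gp4 x y z w)%:R / (span_size U x y z)%:R.

Lemma sat_weight_ge0 x y z w : 0 <= sat_weight x y z w.
Proof. by rewrite divr_ge0. Qed.

(** A saturated triple has at most [span_size] extensions, each of weight [1 / span_size], hence
    total weight at most 1; the 27 counts orderings as in [sum_set3_le]. *)
Lemma sum_sat_weight : sum4 sat_weight <= 27 * #|Sat|%:R.
Proof.
have -> : 27 = 3%:R ^+ 3 :> R by ring.
apply: le_trans (sum_set3_le R U (_ : forall S, S \in Sat -> #|S| = 3%N)); last first.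
  by move=> S; rewrite inE => /andP[/eqP].
apply: ler_sum => x _; apply: ler_sum => y _; apply: ler_sum => z _.
rewrite /sat_weight; have [_|_] := boolP (_ \in Sat); last first.
  by rewrite big1 // => w _; rewrite mul0r.
rewrite -mulr_suml sum_mem /=.
(* For an empty section the convention [0^-1 = 0] makes the weight vanish. *)
have [s0|s0] := posnP (span_size U x y z); first by rewrite s0 invr0 mulr0.
rewrite ler_pdivrMr ?ltr0n // mul1r ler_nat; apply/subset_leq_card/subsetP => w.
by rewrite !inE => /andP[-> /and5P[]].
Qed.

(** A quadruple in [H] is paid for by the lower bound on the section. Any other contains a saturated
    triple, and that triple spans the same plane, so one of the four saturated weights equals the
    left side. *)
Lemma good_weight_le x y z w :
  x \in U -> y \in U -> z \in U -> w \in U ->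
  (good R U x y z && gp4 x y z w)%:R / (span_size U x y z)%:R <=
  2 / mu * ([set x; y; z; w] \in H)%:R + sat_weight x y z w + sat_weight x y w z
  + sat_weight x z w y + sat_weight y z w x.
Proof.
move=> xU yU zU wU; have m0 := mu_gt0 U0.
have p1 := sat_weight_ge0 x y z w; have p2 := sat_weight_ge0 x y w z.
have p3 := sat_weight_ge0 x z w y; have p4 := sat_weight_ge0 y z w x.
have im0 : 0 < 2 / mu by rewrite divr_gt0.
have [/andP[gd g]|_] := boolP (good R U x y z && gp4 x y z w); last first.
  have : 0 <= 2 / mu * ([set x; y; z; w] \in H)%:R by rewrite mulr_ge0 // ltW.
  by move=> h; rewrite mul0r !addr_ge0.
have a0 : mu <= 2 * (span_size U x y z)%:R by case/and5P: gd.
have [eH|eH] := boolP (_ \in H).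
  have : 1%:R / (span_size U x y z)%:R <= 2 / mu :> R.
    rewrite ler_pdivrMr; last by lra.
    by rewrite [leRHS]mulrAC ler_pdivlMr // mul1r.
  rewrite -[nat_of_bool true]/1%N mulr1.
  by move=> h; apply: le_trans h _; rewrite -!addrA lerDl !addr_ge0.
rewrite mulr0 add0r -[nat_of_bool true]/1%N.
have eG : [set x; y; z; w] \in gp_family.
  by apply/gp_familyP; exists x, y, z, w.
have [S [Se S3 SD]] := Hmax eG eH.
have SS : S \in Sat by rewrite inE S3 eqxx.
have [e1 e2 e3] := span_size_gp4 g.
have g2 : gp4 x y w z by rewrite -gp4C34.
have g3 : gp4 x z w y by rewrite -gp4C34 -gp4C23.
have g4 : gp4 y z w x by rewrite -gp4C34 -gp4C23 -gp4C12.
case: (subset_set4_card3 g Se S3) => eS; rewrite eS in SS.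
- have -> : sat_weight x y z w = 1%:R / (span_size U x y z)%:R.
    by rewrite /sat_weight SS g.
  by rewrite -!addrA lerDl !addr_ge0.
- have -> : sat_weight x y w z = 1%:R / (span_size U x y z)%:R.
    by rewrite /sat_weight SS g2 e1.
  by rewrite (addrC (sat_weight x y z w)) -!addrA lerDl !addr_ge0.
- have -> : sat_weight x z w y = 1%:R / (span_size U x y z)%:R.
    by rewrite /sat_weight SS g3 e2.
  by rewrite addrAC lerDr !addr_ge0.
- have -> : sat_weight y z w x = 1%:R / (span_size U x y z)%:R.
    by rewrite /sat_weight SS g4 e3.
  by rewrite lerDr !addr_ge0.
Qed.

(** With at most [4 * #|H| / mu] saturated triples, the constant is
    [3776 = 4 * (2 * 256 + 4 * 27 * 4)]. *)
Lemma good_le_family : mu <= D%:R ->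
  sum3 U (fun x y z => (good R U x y z)%:R) <= 3776 * #|H|%:R / mu.
Proof.
move=> muD; have m0 := mu_gt0 U0.
have H4 e : e \in H -> #|e| = 4%N by move/(subsetP HG)/gp_family_card.
have h1 : sum3 U (fun x y z => (good R U x y z)%:R) <= 4 *
    sum4 (fun x y z w =>
      (good R U x y z && gp4 x y z w)%:R / (span_size U x y z)%:R).
  rewrite mulr_sumr; apply: ler_sum => x _; rewrite mulr_sumr.
  apply: ler_sum => y _; rewrite mulr_sumr; apply: ler_sum => z _.
  have [gd|_] := boolP (good R U x y z); last by rewrite big1 ?mulr0 // => w _; rewrite mul0r.
  rewrite -mulr_suml mulrA ler_pdivlMr; first by rewrite mul1r; exact: good_extensions.
  by case/and5P: gd => _ a0 _ _ _; lra.
have h2 := sum4_le good_weight_le.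
rewrite !sum4D in h2.
rewrite (sum4C34 sat_weight) in h2.
have e3 : sum4 (fun x y z w => sat_weight x z w y) = sum4 sat_weight.
  by rewrite (sum4C23 (fun x y z w => sat_weight x y w z)) sum4C34.
have e4 : sum4 (fun x y z w => sat_weight y z w x) = sum4 sat_weight.
  by rewrite (sum4C12 (fun x y z w => sat_weight x z w y)).
rewrite e3 e4 in h2.
have h3 : sum4 (fun x y z w => 2 / mu * ([set x; y; z; w] \in H)%:R) <=
    2 / mu * (256 * #|H|%:R).
  have -> : 256 = 4%:R ^+ 4 :> R by ring.
  apply: le_trans (ler_wpM2l _ (sum_set4_le R U H4)); last first.
    by rewrite divr_ge0 // ltW.
  rewrite mulr_sumr; apply: ler_sum => x _; rewrite mulr_sumr.
  apply: ler_sum => y _; rewrite mulr_sumr; apply: ler_sum => z _.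
  by rewrite mulr_sumr.
have h4 := sum_sat_weight.
have h5 : mu * #|Sat|%:R <= 4 * #|H|%:R.
  apply: le_trans (_ : D%:R * #|Sat|%:R <= _); first by rewrite ler_wpM2r.
  by rewrite -!natrM ler_nat; exact: (double_count_degree 3 D H4).
have h6 : #|Sat|%:R <= 4 * #|H|%:R / mu by rewrite ler_pdivlMr // mulrC.
have e5 : 2 / mu * (256 * #|H|%:R) = 512 * (#|H|%:R / mu) by ring.
rewrite e5 in h3; rewrite -mulrA in h6; rewrite -[leRHS]mulrA.
lra.
Qed.

End Family.

(** * Degrees of smaller sets, and the choice of constants *)

Lemma family_degree (F : finFieldType) (U : {set 'rV[F]_3}) (H : {set {set 'rV[F]_3}})
    (D i : nat) (S : {set 'rV[F]_3}) :
  H \subset gp_family U ->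
  (forall S : {set 'rV[F]_3}, #|S| = 3%N -> (hdeg H S <= D)%N) ->
  (i < 3)%N -> #|S| = (3 - i)%N -> (hdeg H S <= #|U| ^ i * D)%N.
Proof.
move=> HG HD; elim: i S => [|i IH] S i3 cS; first by rewrite mul1n HD // cS.
rewrite expnS -mulnA; apply: hdeg_extend => [e /(subsetP HG)||x _ xS].
- exact: gp_family_sub.
- by move=> e /(subsetP HG)/gp_family_card->; rewrite cS ltnS leq_subr.
apply: IH; first exact: ltnW.
by rewrite cardsU1 xS cS add1n subnSK // ltnW.
Qed.

Theorem theorem4 (R : realType) :
  exists T c C' q0 : R,
    [/\ 0 < T, 0 < c, 0 < C' & 0 < q0] /\
    forall (F : finFieldType) (U : {set 'rV[F]_3}),
      q0 <= #|F|%:R ->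
      T * #|F|%:R <= #|U|%:R ->
      exists H : {set {set 'rV[F]_3}},
        [/\ H \subset coplanar4 U,
            c * #|U|%:R ^+ 4 / #|F|%:R <= #|H|%:R
          & forall i : nat, (1 <= i <= 3)%N ->
              (max_hdeg U H i)%:R
              <= C' * #|U|%:R ^+ (4 - i)
                 / powR #|F|%:R (1 - (i%:R - 1) / 3)].
Proof.
exists (10 ^+ 8), (64 * 3776)^-1, 2, 512; split.
  by split; rewrite ?exprn_gt0 ?invr_gt0 ?mulr_gt0.
move=> F U q512 hT; set q : R := #|F|%:R in q512 hT *; set N : R := #|U|%:R in hT *.
have q0 : 0 < q by lra.
have T1 : q <= N.
  by apply: le_trans hT; rewrite ler_peMl ?exprn_ege1 // ?ler1n // ltW.
have N0 : 0 < N by lra.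
have m0 : 0 < N / q by rewrite divr_gt0.
(* Rounding up by one gives [N / q <= D]; since [N / q >= 1], also [D <= 2 * (N / q)], whence the
   constant 2 for the degrees. *)
pose D := (#|U| %/ #|F|).+1.
have Fgt0 : (0 < #|F|)%N by rewrite -(ltr_nat R).
have muD : N / q <= D%:R.
  by rewrite ler_pdivrMr // -natrM ler_nat ltnW // ltn_ceil.
have Dmu : D%:R <= 2 * (N / q).
  have le1 : (#|U| %/ #|F|)%:R <= N / q by rewrite ler_pdivlMr // -natrM ler_nat leq_divM.
  have : 1 <= N / q by rewrite ler_pdivlMr // mul1r.
  by rewrite /D -natr1; lra.
have [H [HG Hdeg Hmax]] := maximal_bounded_degree (gp_family U) 3 D.
exists H; split; first exact: subset_trans HG (gp_family_coplanar U).
  have h1 := good_triples N0 q512 hT.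
  have h2 := good_le_family N0 HG Hmax muD.
  have h3 : N ^+ 3 <= 64 * (3776 * #|H|%:R / (N / q)).
    by apply: le_trans h1 _; rewrite ler_wpM2l.
  have {}h3 : N ^+ 3 * (N / q) <= 64 * (3776 * #|H|%:R).
    by rewrite -ler_pdivlMr // -mulrA.
  have c0 : 0 < 64 * 3776 :> R by rewrite mulr_gt0.
  have -> : N ^+ 4 = N ^+ 3 * N by rewrite exprSr.
  by rewrite -mulrA ler_pdivrMl // -[leLHS]mulrA -[leRHS]mulrA.
move=> i /andP[i1 i3].
have hdegi : (max_hdeg U H i <= #|U| ^ (3 - i) * D)%N.
  apply/bigmax_leqP => S /andP[_ /eqP Si].
  apply: (family_degree HG Hdeg); first by rewrite ltn_subrL i1.
  by rewrite subKn.
apply: le_trans (_ : N ^+ (3 - i) * D%:R <= _).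
  by rewrite -natrX -natrM ler_nat.
have -> : (4 - i = (3 - i).+1)%N by rewrite -subSn.
rewrite exprSr.
(* The exponent is at most 1 because [1 <= i], so it suffices to prove the stronger degree bound
   with [q] itself in the denominator. *)
have pq : powR q (1 - (i%:R - 1) / 3) <= q.
  rewrite -[leRHS]powRr1 ?(ltW q0) //; apply: ler_powR; first by lra.
  have : 1 <= i%:R :> R by rewrite ler1n.
  lra.
have p0 : 0 < powR q (1 - (i%:R - 1) / 3) by rewrite powR_gt0.
apply: le_trans (_ : N ^+ (3 - i) * (2 * (N / q)) <= _).
  by rewrite ler_wpM2l // exprn_ge0 // ltW.
have -> : N ^+ (3 - i) * (2 * (N / q)) = 2 * (N ^+ (3 - i) * N) * q^-1 by ring.
have N0' := ltW N0.
apply: ler_wpM2l; first by rewrite !mulr_ge0 ?exprn_ge0.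
by rewrite lef_pV2 // posrE.
Qed.
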